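(* Let $S$ be a $\mathrm{Cu}$-semigroup and let $x,y\in S$ with $x\leq y$. Then: (1) If $x=0$ and $y\neq0$, then $\rho(x,y)=0$ and $\rho(y,x)=\infty$. (2) $\rho(x,y)\leq1$. If further $\mathcal{F}_y(S)\neq\emptyset$ and $x\in\mathrm{Full}(S)$, then $0<\rho(x,y)\leq1$. (3) If $\mathcal{F}_x(S)\neq\emptyset$, then $\rho(y,x)\geq1$. (4) If $\rho(y,x)=1$, then $\widehat{x}=\widehat{y}$. (5) Assume that $x\in\mathrm{Full}(S)$, further $\mathcal{F}_x(S)\neq\emptyset$, and $y\ll\infty\cdot x$. Then $1\leq\rho(y,x)\leq k$ for some $k\in\mathbb{Z}_{>0}$.
   Context: For elements $x,y$ of a partially ordered set $P$, $x\ll y$ means: for every increasing sequence $(y_n)$ in $P$ with supremum $y$ there is $n_0$ with $x\leq y_{n_0}$. A $\mathrm{Cu}$-semigroup is a positively ordered abelian monoid $S$ (so $0\leq x$ for all $x$ and the order is compatible with addition) such that: (O1) every increasing sequence in $S$ has a supremum; (O2) every $x\in S$ is the supremum of a sequence $x_0\ll x_1\ll x_2\ll\cdots$; (O3) if $x'\ll x$ and $y'\ll y$ then $x'+y'\ll x+y$; (O4) $\sup_n(x_n+y_n)=\sup_n x_n+\sup_n y_n$ for all increasing sequences $(x_n),(y_n)$. For $x\in S$, $\infty\cdot x=\sup_n n\cdot x$. An element $x$ is full if $\infty\cdot x$ is the largest element of $S$; $\mathrm{Full}(S)$ is the set of full elements. A functional on $S$ is a map $\lambda\colon S\to[0,\infty]$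 that is additive, order preserving, satisfies $\lambda(0)=0$, and preserves suprema of increasing sequences. $\mathcal{F}(S)$ is the set of functionals on $S$, and $\mathcal{F}_z(S)=\{\lambda\in\mathcal{F}(S):\lambda(z)=1\}$ for $z\in S$. The rank of $x$ is $\widehat{x}\colon\mathcal{F}(S)\to[0,\infty]$, $\widehat{x}(\lambda)=\lambda(x)$. Rank ratio: $\rho(x,y)=\inf\{r\in(0,\infty):\widehat{x}\leq r\cdot\widehat{y}\}$ (pointwise inequality on $\mathcal{F}(S)$), with $\rho(x,y)=\infty$ if there is no such $r$. *)

(* Defs.v *)
From HB Require Import structures.
From mathcomp Require Import all_boot all_order all_algebra.
From mathcomp Require Import boolp classical_sets reals constructive_ereal.
From mathcomp Require Import ereal sequences.

Set Implicit Arguments.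
Unset Strict Implicit.
Unset Printing Implicit Defensive.

Import Order.TTheory GRing.Theory.

Local Open Scope classical_set_scope.
Local Open Scope ring_scope.

(* Sequential compact containment; suprema are taken relationally, so that
   the definition makes sense in any partial order. *)
Definition way_below (d : Order.disp_t) (P : porderType d) (x y : P) : Prop :=
  forall u : nat -> P, nondecreasing_seq u -> supremums (range u) y ->
    exists n0 : nat, (x <= u n0)%O.

Notation "x '<<O' y" := (way_below x y) (at level 70, no associativity).

(* Order.POrder and GRing.Nmodule already have a join in MathComp, namely
   Num.POrderedZmodule, whose elements have opposites; Hierarchy-Builder then
   accepts no monoid-only join, so the addition is bundled here. *)
HB.mixin Record POrder_isPosMonoid (d : Order.disp_t) S of Order.POrder d S := {
  pzero : S;
  padd : S -> S -> S;
  paddA : associative padd;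
  paddC : commutative padd;
  padd0 : left_id pzero padd;
  pzero_le : forall x : S, (pzero <= x)%O;
  le_padd2l : forall z x y : S, (x <= y)%O -> (padd z x <= padd z y)%O
}.

#[short(type="posMonoidType")]
HB.structure Definition PosMonoid (d : Order.disp_t) :=
  { S of Order.POrder d S & POrder_isPosMonoid d S }.

HB.instance Definition _ (d : Order.disp_t) (S : posMonoidType d) :=
  Monoid.isComLaw.Build S pzero padd paddA paddC padd0.

Declare Scope pos_monoid_scope.
Delimit Scope pos_monoid_scope with PM.
Notation "0" := pzero : pos_monoid_scope.
Notation "x + y" := (padd x y) : pos_monoid_scope.
Notation "x *+ n" := (iterop n padd x pzero) : pos_monoid_scope.

HB.mixin Record PosMonoid_isCuSemigroup (d : Order.disp_t) S
    of PosMonoid d S := {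
  cu_O1 : forall u : nat -> S, nondecreasing_seq u ->
    exists s, supremums (range u) s;
  cu_O2 : forall x : S, exists u : nat -> S,
    (forall n, u n <<O u n.+1) /\ supremums (range u) x;
  cu_O3 : forall x' x y' y : S,
    x' <<O x -> y' <<O y -> (x' + y')%PM <<O (x + y)%PM;
  cu_O4 : forall (u v : nat -> S) (s t : S),
    nondecreasing_seq u -> nondecreasing_seq v ->
    supremums (range u) s -> supremums (range v) t ->
    supremums (range (fun n => u n + v n)%PM) (s + t)%PM
}.

#[short(type="cuSemigroupType")]
HB.structure Definition CuSemigroup (d : Order.disp_t) :=
  { S of PosMonoid d S & PosMonoid_isCuSemigroup d S }.

(* The default value 0 of [supremum] is never used: the multiples of x form an
   increasing sequence, which has a supremum by (O1). *)
Definition infty_mul (d : Order.disp_t) (S : cuSemigroupType d) (x : S) : S :=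
  supremum 0%PM (range (fun n : nat => x *+ n)%PM).

Definition Full (d : Order.disp_t) (S : cuSemigroupType d) : set S :=
  [set x | forall y : S, (y <= infty_mul x)%O].
Arguments Full {d} S _.

Record functional (R : realType) (d : Order.disp_t) (S : cuSemigroupType d) :=
  Functional {
    functional_fun :> S -> \bar R;
    functional_ge0 : forall x, (0 <= functional_fun x)%E;
    functionalD : forall x y,
      functional_fun (x + y)%PM = (functional_fun x + functional_fun y)%E;
    functional_le : forall x y,
      (x <= y)%O -> (functional_fun x <= functional_fun y)%E;
    functional0 : functional_fun 0%PM = 0%E;
    functional_sup : forall (u : nat -> S) (s : S),
      nondecreasing_seq u -> supremums (range u) s ->
      ereal_sup (range (fun n => functional_fun (u n))) = functional_fun s
  }.

Definition normalized_functionals (R : realType) (d : Order.disp_t)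
    (S : cuSemigroupType d) (z : S) : set (functional R S) :=
  [set l | l z = 1%E].
Arguments normalized_functionals R {d S} z.

Definition rank (R : realType) (d : Order.disp_t) (S : cuSemigroupType d)
    (x : S) : functional R S -> \bar R :=
  fun l => l x.

(* [ereal_inf set0 = +oo], which is the value when no such r exists. *)
Definition rank_ratio (R : realType) (d : Order.disp_t)
    (S : cuSemigroupType d) (x y : S) : \bar R :=
  ereal_inf [set r%:E | r in [set r : R | 0 < r /\
    forall l : functional R S, (rank x l <= r%:E * rank y l)%E]].
Arguments rank_ratio R {d S} x y.

(* Main.v *)
(* A functional normalized at y bounds rho(x, y) below by its value at x; if x
   is full this value is nonzero, because a functional vanishing at x vanishes
   at infty * x, the largest element. The only upper bound that is not immediate
   is the one in (5): y << infty * x gives y <= n * x for some n. *)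
Require Import Defs.
From mathcomp Require Import all_boot all_order all_algebra.
From mathcomp Require Import boolp classical_sets reals constructive_ereal.
From mathcomp Require Import ereal sequences.
From mathcomp Require Import lra.

Set Implicit Arguments.
Unset Strict Implicit.
Unset Printing Implicit Defensive.

Import Order.TTheory GRing.Theory Num.Theory.

Local Open Scope classical_set_scope.
Local Open Scope ring_scope.

Lemma iterop_paddS (d : Order.disp_t) (S : posMonoidType d) (x : S) (n : nat) :
  (x *+ n.+1 = x + x *+ n)%PM.
Proof. by rewrite !Monoid.iteropE. Qed.

Lemma le_paddl (d : Order.disp_t) (S : posMonoidType d) (x y : S) :
  (x <= y + x)%PM%O.
Proof.
rewrite paddC -[leLHS]padd0 paddC.
exact/le_padd2l/pzero_le.
Qed.

Lemma le_pzero (d : Order.disp_t) (S : posMonoidType d) (x : S) :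
  (x <= 0%PM)%O -> x = 0%PM.
Proof. by move=> x0; apply/le_anti; rewrite x0 pzero_le. Qed.

(** Each summand lies below the sum, and 0 is the least element. This conicality is what makes
    [zero_infty_fun] additive. *)
Lemma padd_eq0 (d : Order.disp_t) (S : posMonoidType d) (x y : S) :
  ((x + y)%PM == 0%PM) = (x == 0%PM) && (y == 0%PM).
Proof.
apply/eqP/andP => [xy0|[/eqP-> /eqP->]]; last exact: padd0.
by split; apply/eqP/le_pzero; rewrite -xy0 ?le_paddl // paddC le_paddl.
Qed.

Lemma nondecreasing_iterop_padd (d : Order.disp_t) (S : posMonoidType d)
    (x : S) : nondecreasing_seq (fun n => x *+ n)%PM.
Proof. by apply/nondecreasing_seqP => n; rewrite iterop_paddS le_paddl. Qed.

Lemma infty_mulP (d : Order.disp_t) (S : cuSemigroupType d) (x : S) :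
  supremums (range (fun n => x *+ n)%PM) (infty_mul x).
Proof.
(* [supremum] falls back on its default only for an empty set; this range contains the multiple for
   n = 0. *)
rewrite /infty_mul /supremum; case: ifPn => [/eqP /seteqP[/(_ 0%PM) range0 _]|_].
  by exfalso; apply: range0; exists 0%N.
by apply: xgetPex; apply: cu_O1; exact: nondecreasing_iterop_padd.
Qed.

Section Functional.
Context {R : realType} {d : Order.disp_t} {S : cuSemigroupType d}.
Implicit Types (x y : S) (l : functional R S).

Lemma functionalMn l x (n : nat) : l (x *+ n)%PM = (n%:R%:E * l x)%E.
Proof.
elim: n => [|n IHn]; first by rewrite functional0 mul0e.
rewrite iterop_paddS functionalD IHn -[n.+1]add1n natrD EFinD.
by rewrite ge0_muleDl ?lee_fin ?ler0n // mul1e.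
Qed.

(** Since [l] preserves suprema, [l (infty_mul x)] is the supremum of the values n * l(x) = 0, and
    fullness puts [y] below [infty_mul x]. *)
Lemma functional_Full_eq0 l x y : Full S x -> l x = 0%E -> l y = 0%E.
Proof.
move=> full_x lx0; apply/le_anti; rewrite functional_ge0 andbT.
apply: le_trans (functional_le l (full_x y)) _.
rewrite -(functional_sup l (nondecreasing_iterop_padd x) (infty_mulP x)).
by apply: ge_ereal_sup => _ [n _ <-]; rewrite functionalMn lx0 mule0.
Qed.

(* Witnesses rho(y, 0) = oo for y <> 0: it is a functional because S is conical,
   and r * 0 never dominates its value at y. *)
Definition zero_infty_fun x : \bar R := if x == 0%PM then 0%E else +oo%E.

Lemma zero_infty_fun_ge0 x : (0 <= zero_infty_fun x)%E.
Proof. by rewrite /zero_infty_fun; case: ifP. Qed.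

Lemma zero_infty_funD x y :
  zero_infty_fun (x + y)%PM = (zero_infty_fun x + zero_infty_fun y)%E.
Proof.
rewrite /zero_infty_fun padd_eq0.
by case: eqP; case: eqP => //= _ _; rewrite ?add0e ?adde0.
Qed.

Lemma zero_infty_fun_le x y :
  (x <= y)%O -> (zero_infty_fun x <= zero_infty_fun y)%E.
Proof.
rewrite /zero_infty_fun => xy; case: (eqVneq y) xy => [->|_ _].
  by move/le_pzero ->; rewrite eqxx.
by rewrite leey.
Qed.

Lemma zero_infty_fun0 : zero_infty_fun 0%PM = 0%E.
Proof. by rewrite /zero_infty_fun eqxx. Qed.

Lemma zero_infty_fun_sup (u : nat -> S) s :
  nondecreasing_seq u -> supremums (range u) s ->
  ereal_sup (range (fun n => zero_infty_fun (u n))) = zero_infty_fun s.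
Proof.
move=> _ [us ls]; apply/le_anti/andP; split.
  apply: ge_ereal_sup => _ [n _ <-].
  by apply/zero_infty_fun_le/us; exists n.
(* Either all terms vanish, and then so does [s], or a single nonzero term already contributes
   +oo. *)
have [u0|/existsNP[n /eqP un0]] := pselect (forall n, u n = 0%PM).
  have -> : s = 0%PM.
    by apply/le_pzero/ls => _ [n _ <-]; rewrite u0.
  apply: ereal_sup_ubound; exists 0%N => //.
  by rewrite u0.
apply: le_trans (ereal_sup_ubound _); last by exists n.
by rewrite {2}/zero_infty_fun (negbTE un0) leey.
Qed.

Definition zero_infty_functional : functional R S :=
  Functional zero_infty_fun_ge0 zero_infty_funD zero_infty_fun_le
    zero_infty_fun0 zero_infty_fun_sup.

Lemma rank_ratio_le x y (r : R) : 0 < r ->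
  (forall l, l x <= r%:E * l y)%E -> (rank_ratio R x y <= r%:E)%E.
Proof. by move=> r0 xy; apply: ereal_inf_lbound; exists r. Qed.

Lemma rank_ratio_ge l x y : l y = 1%E -> (l x <= rank_ratio R x y)%E.
Proof.
move=> ly1; apply: le_ereal_inf_tmp => _ [r [_ /(_ l)] + <-].
by rewrite /rank ly1 mule1.
Qed.

Lemma rank_ratio_le1 x y : (x <= y)%O -> (rank_ratio R x y <= 1)%E.
Proof.
by move=> xy; apply: rank_ratio_le => // l; rewrite mul1e functional_le.
Qed.

Lemma rank_ratio_ge1 x y : (x <= y)%O -> normalized_functionals R x !=set0 ->
  (1 <= rank_ratio R y x)%E.
Proof.
move=> xy [l lx1]; apply: le_trans (rank_ratio_ge _ lx1).
by rewrite -[leLHS]lx1 functional_le.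
Qed.

Lemma rank_ratio0l y : rank_ratio R 0%PM y = 0%E.
Proof.
apply/le_anti/andP; split.
  (* The infimum runs over strictly positive r, so 0 is only approached: every e > 0 is
     admissible. *)
  apply/lee_addgt0Pr => e e0; rewrite add0e; apply: rank_ratio_le => // l.
  by rewrite functional0 mule_ge0 ?functional_ge0 // lee_fin ltW.
by apply: le_ereal_inf_tmp => _ [r [r0 _] <-]; rewrite lee_fin ltW.
Qed.

Lemma rank_ratio0r y : y <> 0%PM -> rank_ratio R y 0%PM = +oo%E.
Proof.
move=> /eqP y0; apply/ereal_inf_pinfty.
move=> _ [r [_ /(_ zero_infty_functional)] + <-].
by rewrite /rank /= zero_infty_fun0 mule0 /zero_infty_fun (negbTE y0).
Qed.

(** The infimum need not be attained, so r = 1 is not directly available. When [l y] is finite,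
    admissible r arbitrarily close to 1 or below it give the bound up to any e > 0; when [l y] is
    +oo there is nothing to show. *)
Lemma rank_ratio_le1_rank x y l : (rank_ratio R x y <= 1)%E -> (l x <= l y)%E.
Proof.
move=> ratio1; have := functional_ge0 l y.
case ly : (l y) => [c| |] // c0; last exact: leey.
rewrite lee_fin in c0.
apply/lee_addgt0Pr => e e0.
have c1 : 0 < c + 1 by lra.
(* With q = e / (c + 1), r < 1 + q yields r * c <= c + q * c <= c + e. Dividing by c + 1 rather than
   c also covers c = 0. *)
have /ereal_inf_lt[_ [r [r0 /(_ l)] + <-]] :
    (rank_ratio R x y < (1 + e / (c + 1))%:E)%E.
  by apply: le_lt_trans ratio1 _; rewrite lte_fin ltrDl divr_gt0.
rewrite /rank ly lte_fin => lxr rlt; apply: le_trans lxr _.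
rewrite -EFinM -EFinD lee_fin.
have : e / (c + 1) * (c + 1) = e by rewrite divfK ?gt_eqF.
have : 0 < e / (c + 1) by rewrite divr_gt0.
move: (e / _) rlt => q rlt q0 qc.
nra.
Qed.

Lemma way_below_infty_mul_rank_ratio x y : y <<O infty_mul x ->
  exists k : nat, (0 < k)%N /\ (rank_ratio R y x <= k%:R%:E)%E.
Proof.
move=> /(_ _ (nondecreasing_iterop_padd x) (infty_mulP x)) [n yn].
(* The [n] from compact containment may be 0, whereas an admissible ratio must be positive; passing
   to the next multiple only enlarges the bound. *)
exists n.+1; split=> //; apply: rank_ratio_le => [|l]; first by rewrite ltr0n.
rewrite -functionalMn; apply: functional_le; apply: le_trans yn _.
exact: nondecreasing_iterop_padd.
Qed.

End Functional.

Theorem lemma4p4 (R : realType) (d : Order.disp_t) (S : cuSemigroupType d)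
    (x y : S) (le_xy : (x <= y)%O) :
  (x = 0%PM -> y <> 0%PM ->
     rank_ratio R x y = 0%E /\ rank_ratio R y x = +oo%E) /\
  ((rank_ratio R x y <= 1)%E /\
   (normalized_functionals R y !=set0 -> Full S x ->
      (0 < rank_ratio R x y)%E /\ (rank_ratio R x y <= 1)%E)) /\
  (normalized_functionals R x !=set0 -> (1 <= rank_ratio R y x)%E) /\
  (rank_ratio R y x = 1%E -> rank x = rank y :> (functional R S -> \bar R)) /\
  (Full S x -> normalized_functionals R x !=set0 -> y <<O infty_mul x ->
     exists k : nat, (0 < k)%N /\
       (1 <= rank_ratio R y x)%E /\ (rank_ratio R y x <= k%:R%:E)%E).
Proof.
split; [|split; [split|split; [|split]]].
- by move=> -> y0; rewrite rank_ratio0l rank_ratio0r.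
- exact: rank_ratio_le1.
- move=> [l ly1] full_x; split; last exact: rank_ratio_le1.
  apply: lt_le_trans (rank_ratio_ge _ ly1).
  rewrite lt_neqAle functional_ge0 andbT; apply/eqP => lx0.
  have := functional_Full_eq0 y full_x (esym lx0).
  by rewrite ly1 => /eqP; rewrite onee_eq0.
- exact: rank_ratio_ge1.
(* Monotonicity of [l] gives one inequality, the bound on the ratio the reverse one. *)
- move=> ratio1; apply/funext => l; apply/le_anti.
  by rewrite /rank functional_le //= rank_ratio_le1_rank // ratio1.
- move=> _ Fx /(@way_below_infty_mul_rank_ratio R) [k [k0 le_k]].
  by exists k; split=> //; split=> //; exact: rank_ratio_ge1.
Qed.
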